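(* Let $p$ be an odd prime. For an integer $j$ with $0\le j\le 2p-1$ and a positive integer $n$, write $\Phi(2pn-j)=\sum_{m=1}^{n}\phi(2pm-j)$. Then: (a) for every even $j\in\{2,4,\dots,2p-2\}$, $$\lim_{n\to\infty}\frac{\Phi(2pn-j)}{(2pn)^2}=\frac{p}{(p^2-1)\pi^2},$$ and $$\lim_{n\to\infty}\frac{\Phi(2pn)}{(2pn)^2}=\frac{1}{(p+1)\pi^2};$$ (b) for every odd $j\in\{1,3,\dots,2p-1\}$ with $j\neq p$, $$\lim_{n\to\infty}\frac{\Phi(2pn-j)}{(2pn)^2}=\frac{2p}{(p^2-1)\pi^2},$$ and $$\lim_{n\to\infty}\frac{\Phi(2pn-p)}{(2pn)^2}=\frac{2}{(p+1)\pi^2}.$$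
   Context: $\phi$ denotes Euler's totient function: $\phi(n)$ is the number of positive integers not exceeding $n$ that are relatively prime to $n$ (so $\phi(1)=1$). The notation $\Phi(2pn-j)$ stands for the sum of $\phi$ over the first $n$ positive members of the arithmetic progression $2pm-j$, $m=1,2,\dots,n$ (and not for the sum of $\phi$ over all positive integers up to $2pn-j$). In particular $\Phi(2pn)=\sum_{m=1}^n\phi(2pm)$. *)

(* Defs.v *)
From HB Require Import structures.
From mathcomp Require Import all_boot all_order all_algebra.
From mathcomp Require Import all_classical all_reals all_analysis.

Set Implicit Arguments.
Unset Strict Implicit.
Unset Printing Implicit Defensive.

Import Order.TTheory GRing.Theory Num.Theory.
Import numFieldNormedType.Exports.

(* This is usually written Phi(2pn - j), but it depends on p, j and n
   separately, not on the number 2pn - j.  Since m >= 1, the truncated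
   subtraction is exact for j <= 2p - 1. *)
Definition totient_AP_sum (p j n : nat) : nat :=
  (\sum_(1 <= m < n.+1) totient (2 * p * m - j))%N.

(* Main.v *)
Require Import Defs.
From HB Require Import structures.
From mathcomp Require Import all_boot all_order all_algebra.
From mathcomp Require Import all_classical all_reals all_analysis.
From mathcomp Require Import cyclic.
From mathcomp Require Import ring lra zify.

Set Implicit Arguments.
Unset Strict Implicit.
Unset Printing Implicit Defensive.

Import Order.TTheory GRing.Theory Num.Theory.
Import numFieldNormedType.Exports.
Local Open Scope classical_set_scope.
Local Open Scope ring_scope.

(** Write [T q a x] for the sum of [totient k] over the [k <= x] congruent to [a]
    modulo [q], and [Z q] for the sum of [1 / d ^ 2] over all [d] coprime to
    [q].  The first [n] terms of the progression [2pm - j] are exactly the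
    integers of [1, 2pn] in the class of [2p - j] modulo [2p], so the theorem is
    about the limits of [T (2p) a x / x ^ 2], one for each residue [a].

    Classes coprime to the modulus ([totient_class_sum_density]).  Summing
    [k = sum of totient (k / d) over the divisors d of k] over the
    [k <= x] in the class of [a] gives
<<
      x ^ 2 / (2 q) + O(x) = sum over d <= x coprime to q of T q (a / d) (x / d),
>>
    where [a / d] is computed modulo [q].  If all [T q b x] behave like [c x ^ 2],
    this forces [c = 1 / (2 q Z q)].  That they do behave so needs no Moebius
    inversion: the errors [T q b x - c x ^ 2] satisfy the same relation with
    right-hand side [o(x ^ 2)], and its term [d = 1] dominates the others
    because the sum of [1 / d ^ 2] over [d >= 2] is below [1].  Hence an
    eventual bound [B x ^ 2] on all the errors can be improved to
    [(7 / 8) B x ^ 2], again and again ([contraction_negligible]).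

    The constants.  [Z 2 = pi ^ 2 / 8] follows from the duplication formula
    [1 / sin x ^ 2 + 1 / cos x ^ 2 = 4 / sin (2 x) ^ 2], which evaluates the sum
    of [1 / sin t ^ 2] over the odd multiples [t] of [pi / 2 ^ (n + 2)] below
    [pi / 2], together with [1 / sin t ^ 2 - 1 <= 1 / t ^ 2 <= 1 / sin t ^ 2].
    A prime [r] not dividing [q] contributes an Euler factor:
    [Z (r q) = (1 - 1 / r ^ 2) Z q]; this also yields [Z 1 = pi ^ 2 / 6].

    The other classes modulo [2p] are obtained by subtraction.  A class modulo
    [q] is the disjoint union of the classes modulo [q m] above it, [m] coprime
    to [q].  For [a] even and prime to [p], the class of [a] modulo [p] is made of
    the class of [a] modulo [2p] and of one class coprime to [2p].  The odd
    (even) integers are made of the class of [p] (of [0]) modulo [2p] and of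
    [p - 1] classes that are prime to [p], all of the same density. *)

(** * Totient sums over residue classes *)

Lemma sum_multiples (V : nmodType) (F : nat -> V) (d x : nat) : (0 < d)%N ->
  \sum_(1 <= k < x.+1 | (d %| k)%N) F k =
  \sum_(1 <= e < (x %/ d).+1) F (d * e)%N.
Proof.
move=> d0; elim: x => [|x IH]; first by rewrite div0n !big_geq.
rewrite big_mkcond big_nat_recr //= -big_mkcond /= IH divnS //.
case: (boolP (d %| x.+1)%N) => [dx|_]; last by rewrite add0n addr0.
rewrite add1n [RHS]big_nat_recr //=; congr (_ + F _).
by rewrite -[LHS](divnK dx) divnS // dx add1n mulnC.
Qed.

Lemma sum_totient_codivisors (k x : nat) : (0 < k <= x)%N ->
  (\sum_(1 <= d < x.+1 | (d %| k)%N) totient (k %/ d) = k)%N.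
Proof.
case/andP=> k0 kx.
rewrite -[RHS]sum_totient_dvd (@big_cat_nat _ _ _ k.+1) //=.
rewrite [X in (_ + X)%N]big_nat_cond [X in (_ + X)%N]big1; last first.
  by move=> d /andP[/andP[kd _] /(dvdn_leq k0)]; rewrite leqNgt kd.
have -> : (\sum_(1 <= d < k.+1 | (d %| k)%N) totient (k %/ d) =
           \sum_(d < k.+1 | (d %| k)%N) totient (k %/ d))%N.
  rewrite -(big_mkord (fun d => d %| k)%N (fun d => totient (k %/ d))).
  rewrite [RHS]big_mkcond [RHS]big_nat_recl //= dvd0n (gtn_eqF k0).
  by rewrite [LHS]big_mkcond big_add1.
(* [d |-> k %/ d] is an involution of the divisors of [k]. *)
have kK (d : 'I_k.+1) : (d %| k -> k %/ (k %/ d) = d)%N.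
  by move=> dk; rewrite divnA // mulKn.
rewrite addn0 (reindex_onto (fun d : 'I_k.+1 => inord (k %/ d)%N)
                 (fun d : 'I_k.+1 => inord (k %/ d)%N)) /=.
  apply: eq_big => d; rewrite !inordK ?ltnS ?leq_div //.
    apply/andP/idP => [[kd]|dk].
      move=> /eqP/(congr1 val); rewrite /= inordK ?ltnS ?leq_div // => <-.
      exact: dvdn_div.
    split; first exact: dvdn_div.
    by apply/eqP/val_inj; rewrite /= inordK ?ltnS ?leq_div // kK.
  move=> /andP[kd /eqP/(congr1 val)].
  by rewrite /= inordK ?ltnS ?leq_div // => ->.
move=> d dk; apply/val_inj.
by rewrite /= !inordK ?ltnS ?leq_div ?kK.
Qed.

Definition totient_class_sum (q a x : nat) : nat :=
  (\sum_(1 <= k < x.+1 | k == a %[mod q]) totient k)%N.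

Lemma eq_totient_class_sum (q a b x : nat) : a = b %[mod q] ->
  totient_class_sum q a x = totient_class_sum q b x.
Proof. by move=> ab; apply: eq_bigl => k; rewrite ab. Qed.

Lemma totient_leq (k : nat) : (totient k <= k)%N.
Proof.
rewrite totient_count_coprime; apply: leq_trans (leq_sum _ (fun i _ => leq_b1 _)) _.
by rewrite sum_nat_const_nat muln1 subn0.
Qed.

Lemma totient_class_sum_leq (q a x : nat) : (totient_class_sum q a x <= x ^ 2)%N.
Proof.
rewrite /totient_class_sum big_mkcond /=.
apply: (@leq_trans (\sum_(1 <= k < x.+1) x)); last first.
  by rewrite sum_nat_const_nat subn1 mulnn.
rewrite big_nat_cond [leqRHS]big_nat_cond; apply: leq_sum => k /andP[/andP[_ kx] _].
by case: ifP => // _; exact: leq_trans (totient_leq k) _.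
Qed.

(** The divisor identity [k = sum of totient (k %/ d)], summed over a class
    coprime to [q] and regrouped by [d]: with [k = d * e], the condition on [k]
    puts [e] in the class of [a / d].  Euler's theorem provides the inverse
    [d ^ (totient q).-1] of [d]; no [d] sharing a factor with [q] occurs. *)
Lemma sum_class_totient (q a x : nat) : (0 < q)%N -> coprime a q ->
  (\sum_(1 <= k < x.+1 | k == a %[mod q]) k =
   \sum_(1 <= d < x.+1 | coprime d q)
     totient_class_sum q (a * d ^ (totient q).-1) (x %/ d))%N.
Proof.
move=> q0 aq.
have inv d : coprime d q -> (d * d ^ (totient q).-1 = 1 %[mod q])%N.
  by move=> dq; rewrite -expnS prednK ?totient_gt0 // Euler_exp_totient.
transitivity (\sum_(1 <= k < x.+1) \sum_(1 <= d < x.+1 | d %| k)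
  if k == a %[mod q] then totient (k %/ d) else 0)%N.
  rewrite big_mkcond big_nat_cond [RHS]big_nat_cond.
  apply: eq_bigr => k /andP[kx _]; case: ifP => _; last by rewrite big1.
  by rewrite sum_totient_codivisors.
rewrite (exchange_big_dep xpredT) //= [RHS]big_mkcond /= big_nat_cond [RHS]big_nat_cond.
apply: eq_bigr => d /andP[/andP[d0 dx] _].
rewrite (@sum_multiples nat) //= -big_mkcond.
have [dq|dq] := boolP (coprime d q); last first.
  apply: big1 => e /eqP dea; case/negP: dq.
  have : coprime ((d * e) %% q) q by rewrite dea coprime_modl.
  by rewrite coprime_modl coprimeMl => /andP[].
apply: eq_big => [e|e _]; last by rewrite mulKn.
apply/eqP/eqP => ea.
  by rewrite -modnMml -ea modnMml mulnAC -modnMml inv // modnMml mul1n.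
by rewrite -modnMmr ea modnMmr mulnCA -modnMmr inv // modnMmr muln1.
Qed.

(** Each block [q * i + 1, q * i + q] of length [q] meets the class of [r] once;
    the representative [r] is taken in [1, q], not in [0, q - 1], because the
    range of summation starts at [1]. *)
Lemma sum_class_blocks (V : nmodType) (F : nat -> V) (q r n : nat) :
  (1 <= r <= q)%N ->
  \sum_(1 <= k < (q * n).+1 | k == r %[mod q]) F k =
  \sum_(0 <= i < n) F (q * i + r)%N.
Proof.
case/andP=> r1 rq; elim: n => [|n IH]; first by rewrite muln0 !big_geq.
rewrite big_nat_recr //= -IH (@big_cat_nat _ _ _ (q * n).+1) //=; last first.
  by rewrite ltnS leq_mul2l leqnSn orbT.
congr (_ + _).
rewrite big_mkcond (bigD1_seq (q * n + r)%N) ?iota_uniq //=; last first.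
  by rewrite mem_index_iota mulnS; lia.
rewrite mulnC modnMDl eqxx [X in _ + X]big_nat_cond [X in _ + X]big1 ?addr0 //.
move=> k /andP[/andP[k1 k2] kr]; case: ifP => // kqr; case/negP: kr.
move: k1 k2 kqr; rewrite mulnS (mulnC q) => k1 k2.
have -> : k = (n * q + ((k - n * q - 1) + 1))%N by lia.
rewrite modnMDl -{1}(subnK r1) eqn_modDr !modn_small; lia.
Qed.

(** By the Chinese remainder theorem, a class modulo [q] is the disjoint union of
    the [m] classes modulo [q * m] above it. *)
Lemma totient_class_sum_split (q m a x : nat) : (0 < m)%N -> coprime q m ->
  totient_class_sum q a x =
  (\sum_(b < m) totient_class_sum (q * m) (chinese q m a b) x)%N.
Proof.
move=> m0 qm; rewrite /totient_class_sum.
rewrite (exchange_big_dep (fun k => k == a %[mod q])) /=; last first.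
  by move=> b k _; rewrite chinese_remainder // => /andP[+ _]; rewrite chinese_modl.
apply: eq_bigr => k /eqP ka.
rewrite (big_pred1 (Ordinal (ltn_pmod k m0))) // => b.
rewrite chinese_remainder // chinese_modl // chinese_modr // ka eqxx /=.
by rewrite -val_eqE /= [RHS]eq_sym (modn_small (ltn_ord b)).
Qed.
(** The sum of a class up to [x] is [x ^ 2 / (2 q) + O(x)]; the inequalities are
    multiplied out to stay within the natural numbers.  The sum is squeezed
    between its values at the multiples of [q] on both sides of [x]. *)
Lemma class_sum_bounds (q a x : nat) : (0 < q)%N ->
  (let g := \sum_(1 <= k < x.+1 | k == a %[mod q]) k in
   2 * q * g <= x ^ 2 + 3 * q * x + 2 * q ^ 2 /\
   x ^ 2 <= 2 * q * g + 3 * q * x + 2 * q ^ 2)%N.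
Proof.
move=> q0 g.
pose r := (if a %% q == 0 then q else a %% q)%N.
have r1q : (1 <= r <= q)%N.
  by rewrite /r; case: eqP => [|/eqP] h; have := ltn_pmod a q0; lia.
have ra : (r = a %[mod q])%N.
  by rewrite /r; case: eqP => [->|_]; rewrite ?modnn ?modn_mod.
have mono (y z : nat) : (y <= z ->
    \sum_(1 <= k < y.+1 | k == a %[mod q]) k <=
    \sum_(1 <= k < z.+1 | k == a %[mod q]) k)%N.
  by move=> yz; rewrite [leqRHS](@big_cat_nat _ _ _ y.+1) //= leq_addr.
have gauss n : ((\sum_(0 <= i < n) i) * 2 = n * (n - 1))%N.
  elim: n => [|n IH]; first by rewrite big_geq.
  by rewrite big_nat_recr //= mulnDl IH; nia.
have block n : (\sum_(1 <= k < (q * n).+1 | k == a %[mod q]) k =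
    q * (\sum_(0 <= i < n) i) + n * r)%N.
  transitivity (\sum_(1 <= k < (q * n).+1 | k == r %[mod q]) k)%N.
    by apply: eq_bigl => k; rewrite ra.
  rewrite (@sum_class_blocks nat id) // big_split /= big_distrr /=.
  by rewrite sum_nat_const_nat subn0.
have xq := divn_eq x q; have xq' := ltn_pmod x q0.
pose n := (x %/ q)%N.
have glow : (\sum_(1 <= k < (q * n).+1 | k == a %[mod q]) k <= g)%N.
  by apply: mono; rewrite /n; lia.
have gup : (g <= \sum_(1 <= k < (q * n.+1).+1 | k == a %[mod q]) k)%N.
  by apply: mono; rewrite /n; lia.
move: glow gup; rewrite !block => glow gup.
have := gauss n; have := gauss n.+1.
move: (\sum_(0 <= i < n.+1) i)%N (\sum_(0 <= i < n) i)%N glow gup => s t.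
move=> glow gup; rewrite subn1 /= => s2 t2.
case/andP: r1q => _ rq.
have up : (2 * g <= q * (n.+1 * n) + 2 * (n.+1 * q))%N.
  rewrite -s2 mulnA [X in (_ <= X + _)%N]mulnC -mulnDr leq_mul2l /=.
  by apply: leq_trans gup _; rewrite leq_add2l leq_mul.
have lo : (q * (n * (n - 1)) <= 2 * g)%N.
  rewrite -t2 mulnA [leqLHS]mulnC leq_mul2l /=.
  by apply: leq_trans glow; rewrite leq_addr.
have nqx : (n * q <= x)%N by rewrite xq leq_addr.
have xnq : (x <= n * q + q)%N by rewrite {1}xq leq_add2l ltnW.
have up2 := leq_mul (leqnn q) up; have lo2 := leq_mul (leqnn q) lo.
have sq1 : ((n * q) ^ 2 <= x ^ 2)%N by rewrite leq_exp2r.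
have sq2 : (x ^ 2 <= (n * q + q) ^ 2)%N by rewrite leq_exp2r.
have lin : (q * (n * q) <= q * x)%N by rewrite leq_mul.
have e1 : (q * (q * (n.+1 * n) + 2 * (n.+1 * q)) =
    (n * q) ^ 2 + 3 * (q * (n * q)) + 2 * q ^ 2)%N by rewrite -addn1; ring.
have e2 : ((n * q + q) ^ 2 = (n * q) ^ 2 + 2 * (q * (n * q)) + q ^ 2)%N by ring.
have e3 : ((n * q) ^ 2 <= q * (q * (n * (n - 1))) + q * (n * q))%N.
  by case: (n) => // m; rewrite subn1 /= -[m.+1]addn1; apply/eq_leq; ring.
move: up2 lo2 sq2 e3; rewrite e1 e2.
have -> : (q * (2 * g) = 2 * q * g)%N by ring.
have -> : (3 * q * x = 3 * (q * x))%N by ring.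
clear -sq1 lin; move: ((n * q) ^ 2)%N (q * (n * q))%N (q ^ 2)%N (q * x)%N sq1 lin.
move: (2 * q * g)%N (x ^ 2)%N (q * (q * (n * (n - 1))))%N; lia.
Qed.

(** * The contraction argument *)

Section contraction.
Variable R : realType.

Lemma sum_inv_sqr_ge2 (x : nat) :
  \sum_(2 <= d < x.+1) (d%:R : R) ^- 2 <= 3 / 4.
Proof.
case: x => [|[|x]]; [by rewrite big_geq // divr_ge0..|].
(* The tail is compared with the telescoping sum of [1 / d - 1 / (d + 1)]. *)
suff H : \sum_(2 <= d < x.+3) (d%:R : R) ^- 2 <= 3 / 4 - x.+2%:R^-1.
  by apply: le_trans H _; rewrite gerBl invr_ge0.
elim: x => [|x IH]; first by rewrite big_nat1; lra.
rewrite big_nat_recr //=; apply: le_trans (lerD IH (lexx _)) _.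
rewrite -addrA lerD2l -[x.+3]addn1 natrD.
have : 0 < x.+2%:R :> R by rewrite ltr0n.
move: (x.+2%:R : R) => y y0.
rewrite addrC -subr_ge0.
have -> : - (y + 1)^-1 - ((y + 1) ^- 2 - y^-1) = (y * (y + 1) ^+ 2)^-1.
  by field; rewrite !gt_eqF ?addr_gt0.
by rewrite invr_ge0 mulr_ge0 ?sqr_ge0 // ltW.
Qed.

(** If [U x <= b x ^ 2] for all [x >= N], the terms with [x / d >= N] contribute at
    most [b x ^ 2] times the sum of [1 / d ^ 2] over [d >= 2], that is at most
    [(3 / 4) b x ^ 2], and the remaining terms, each below [B N ^ 2], are
    [O(x)].  So [b] can be replaced with [(7 / 8) b], and iterating brings it
    below any positive number. *)
Lemma contraction_negligible (U eta : nat -> R) (B : R) :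
  (forall x, 0 <= U x <= B * x%:R ^+ 2) ->
  (forall x, U x <= eta x + \sum_(2 <= d < x.+1) U (x %/ d)%N) ->
  eta x / x%:R ^+ 2 @[x --> \oo] --> 0 ->
  U x / x%:R ^+ 2 @[x --> \oo] --> 0.
Proof.
move=> UB Urec eta0.
have U0 x : 0 <= U x by have /andP[] := UB x.
pose P b := \forall x \near \oo, U x <= b * x%:R ^+ 2.
have step b : 0 < b -> P b -> P (7 / 8 * b).
  move=> b0 [N _ HN].
  have b16 : 0 < b / 16 by rewrite divr_gt0.
  near=> x.
  have x0 : 0 < x%:R :> R by rewrite ltr0n; near: x; exact: nbhs_infty_gt.
  have etax : eta x <= b / 16 * x%:R ^+ 2.
    rewrite -ler_pdivrMr ?exprn_gt0 //; apply: le_trans (ler_norm _) _.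
    by near: x; move/cvgr0Pnorm_le : eta0; exact.
  have smallx : `|B| * N%:R ^+ 2 * x%:R <= b / 16 * x%:R ^+ 2.
    rewrite [x%:R ^+ 2]expr2 mulrA ler_pM2r // -ler_pdivrMl //.
    by near: x; exact: nbhs_infty_ger.
  have sumx : \sum_(2 <= d < x.+1) U (x %/ d)%N <=
      3 / 4 * b * x%:R ^+ 2 + `|B| * N%:R ^+ 2 * x%:R.
    apply: (@le_trans _ _ (\sum_(2 <= d < x.+1)
        (b * x%:R ^+ 2 * d%:R ^- 2 + `|B| * N%:R ^+ 2))).
      rewrite big_nat_cond [leRHS]big_nat_cond; apply: ler_sum => d.
      move=> /andP[/andP[d2 _] _].
      have d0 : 0 < d%:R :> R by rewrite ltr0n (leq_trans _ d2).
      have [xN|xN] := leqP N (x %/ d).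
        apply: le_trans (HN _ xN) _; rewrite -[leLHS]addr0 lerD ?mulr_ge0 //.
        rewrite -mulrA ler_pM2l // -exprVn -exprMn ler_pXn2r ?nnegrE ?mulr_ge0 //.
        by rewrite ler_pdivlMr // -natrM ler_nat leq_divM.
      have /andP[_ /le_trans] := UB (x %/ d)%N; apply.
      have t0 : 0 <= b * x%:R ^+ 2 * d%:R ^- 2.
        by apply: divr_ge0; rewrite ?sqr_ge0 // mulr_ge0 ?sqr_ge0 // ltW.
      rewrite -[leLHS]add0r lerD //.
      apply: (@le_trans _ _ (`|B| * (x %/ d)%:R ^+ 2)).
        by rewrite ler_wpM2r ?sqr_ge0 // ler_norm.
      rewrite ler_wpM2l //.
      by rewrite ler_pXn2r ?nnegrE // ler_nat ltnW.
    rewrite big_split /= -big_distrr /= sumr_const_nat lerD //.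
      rewrite -[leRHS]mulrA [leRHS]mulrC ler_wpM2l ?sum_inv_sqr_ge2 //.
      by rewrite mulr_ge0 ?sqr_ge0 // ltW.
    by rewrite -[leLHS]mulr_natr ler_wpM2l ?mulr_ge0 // ler_nat; lia.
  rewrite (le_trans (Urec x)) //.
  by move: etax smallx sumx; set s := \sum_(_ <= _ < _) _; lra.
have iter n : P ((7 / 8) ^+ n * (`|B| + 1)).
  elim: n => [|n IH].
    exists 0%N => // x _ /=; rewrite expr0 mul1r.
    have /andP[_ /le_trans] := UB x; apply.
    by rewrite ler_wpM2r ?sqr_ge0 // ler_wpDr // ler_norm.
  by rewrite exprS -mulrA; apply: step.
apply/cvgr0Pnorm_le => e e0.
have geom0 : (7 / 8) ^+ n * (`|B| + 1) @[n --> \oo] --> (0 : R).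
  rewrite -[X in _ --> X](mul0r (`|B| + 1)); apply: cvgMr_tmp.
  by apply: cvg_expr; rewrite ger0_norm ?divr_ge0 //; lra.
have /cvgr0Pnorm_le/(_ e e0)[n _ Hn] := geom0.
have {}Hn := Hn n (leqnn n).
near=> x.
have x0 : 0 < x%:R :> R by rewrite ltr0n; near: x; exact: nbhs_infty_gt.
rewrite ger0_norm ?divr_ge0 // ler_pdivrMr ?exprn_gt0 //.
have Ux : U x <= (7 / 8) ^+ n * (`|B| + 1) * x%:R ^+ 2.
  by near: x; exact: iter.
apply: le_trans Ux _; rewrite ler_wpM2r ?sqr_ge0 //.
by apply: le_trans Hn; exact: ler_norm.
Unshelve. all: by end_near.
Qed.
End contraction.

(** * Density of the classes coprime to the modulus *)

Section density.
Variable R : realType.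

Definition coprime_inv_squares (q n : nat) : R :=
  \sum_(1 <= d < n.+1 | coprime d q) d%:R ^- 2.

Lemma cvg_quadratic (f : nat -> R) (l A : R) :
  (forall x, `|f x - l * x%:R ^+ 2| <= A * x.+1%:R) ->
  f x / x%:R ^+ 2 @[x --> \oo] --> l.
Proof.
move=> fA; apply/cvgrPdist_le => e e0; near=> x.
have x1 : 1 <= x%:R :> R by near: x; exact: nbhs_infty_ger.
have x0 : 0 < x%:R :> R by rewrite (lt_le_trans _ x1).
have xA : 2 * `|A| / e <= x%:R by near: x; exact: nbhs_infty_ger.
have -> : l - f x / x%:R ^+ 2 = (l * x%:R ^+ 2 - f x) / x%:R ^+ 2.
  by field; rewrite gt_eqF.
rewrite normrM [X in _ * X]ger0_norm ?invr_ge0 ?sqr_ge0 // ler_pdivrMr ?exprn_gt0 //.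
rewrite distrC; apply: le_trans (fA x) _.
apply: (@le_trans _ _ (`|A| * (2 * x%:R))).
  apply: (@le_trans _ _ (`|A| * x.+1%:R)); first by rewrite ler_wpM2r // ler_norm.
  by rewrite ler_wpM2l // -[x.+1]addn1 natrD; lra.
rewrite expr2 !mulrA ler_pM2r //.
by rewrite -ler_pdivrMl // mulrC [_ * 2]mulrC.
Unshelve. all: by end_near.
Qed.

Lemma cvg_class_sum (q a : nat) : (0 < q)%N ->
  (\sum_(1 <= k < x.+1 | k == a %[mod q]) k)%N%:R / x%:R ^+ 2 @[x --> \oo]
    --> ((2 * q%:R)^-1 : R).
Proof.
move=> q0; apply: (@cvg_quadratic _ _ (3 * q%:R)) => x.
have [lo up] := class_sum_bounds a x q0.
move: (\sum_(_ <= _ < _ | _) _)%N lo up => g.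
rewrite -(ler_nat R) -(ler_nat R (x ^ 2)) !natrD ?natrX !natrM ?natrX.
rewrite -[x.+1]addn1 natrD => lo up.
have q1 : 1 <= q%:R :> R by rewrite ler1n.
have -> : g%:R - (2 * q%:R)^-1 * x%:R ^+ 2 =
    (2 * q%:R * g%:R - x%:R ^+ 2) / (2 * q%:R) :> R.
  by field; rewrite gt_eqF // (lt_le_trans _ q1).
rewrite normrM [X in _ * X]ger0_norm; last by rewrite invr_ge0; lra.
rewrite ler_pdivrMr; last by lra.
have x0 : 0 <= x%:R :> R by [].
move: (x%:R : R) (q%:R : R) (g%:R : R) lo up q1 x0 => X Q G lo up q1 x0.
have QX : Q * X <= Q ^+ 2 * X by rewrite ler_wpM2r // expr2 ler_pMl; lra.
have Q2 : 0 <= Q ^+ 2 by rewrite sqr_ge0.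
rewrite ler_norml; apply/andP; split; nra.
Qed.

Lemma cvg_harmonic_mean :
  (\sum_(1 <= d < x.+1) d%:R^-1) / x%:R @[x --> \oo] --> (0 : R).
Proof.
have := cesaro (@cvg_harmonic R); rewrite -[X in _ -> X]cvg_shiftS.
apply: cvg_trans; apply: near_eq_cvg.
apply: nearW => x; rewrite /arithmetic_mean /= seriesEnat /= mulrC.
by congr (_ / _); rewrite [RHS]big_add1.
Qed.

(** [(x %/ d) ^ 2] differs from [(x / d) ^ 2] by at most [2 x / d], so the total
    error is [2 x] times a harmonic sum.  Divided by [x ^ 2] it is twice the
    arithmetic mean of [1, 1/2, ..., 1/x], which tends to [0] by Cesaro's
    lemma. *)
Lemma cvg_floor_squares (q : nat) (Z : R) :
  coprime_inv_squares q n @[n --> \oo] --> Z ->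
  (\sum_(1 <= d < x.+1 | coprime d q) (x %/ d)%:R ^+ 2) / x%:R ^+ 2 @[x --> \oo] --> Z.
Proof.
move=> cZ.
have lowZ : coprime_inv_squares q x - 2 * ((\sum_(1 <= d < x.+1) d%:R^-1) / x%:R)
    @[x --> \oo] --> Z.
  rewrite -[X in _ --> X]subr0 -[X in _ --> _ - X](mulr0 2); apply: cvgB => //.
  by apply: cvgMl_tmp; exact: cvg_harmonic_mean.
apply: squeeze_cvgr lowZ cZ; near=> x.
have x0 : 0 < x%:R :> R by rewrite ltr0n; near: x; exact: nbhs_infty_gt.
rewrite ler_pdivlMr ?ler_pdivrMr ?exprn_gt0 //.
have -> : (coprime_inv_squares q x - 2 * ((\sum_(1 <= d < x.+1) d%:R^-1) / x%:R)) *
    x%:R ^+ 2 =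
  x%:R ^+ 2 * coprime_inv_squares q x - 2 * x%:R * \sum_(1 <= d < x.+1) d%:R^-1.
  by move: (\sum_(_ <= _ < _) _) => h; field; rewrite gt_eqF.
rewrite /coprime_inv_squares !big_distrr /= [X in _ <= _ <= X]mulrC big_distrr /=.
apply/andP; split.
  rewrite [X in X - _]big_mkcond -sumrB [leRHS]big_mkcond /=.
  rewrite big_nat_cond [leRHS]big_nat_cond; apply: ler_sum => d /andP[/andP[d1 dx] _].
  have d0 : 0 < d%:R :> R by rewrite ltr0n.
  case: ifP => _; last by rewrite subr_le0 mulr_ge0 ?mulr_ge0 ?invr_ge0 ?ltW.
  have : x%:R / d%:R <= (x %/ d)%:R + 1 :> R.
    by rewrite ler_pdivrMr // natr1 -natrM ler_nat ltnW // ltn_ceil.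
  have -> : x%:R ^+ 2 / d%:R ^+ 2 = (x%:R / d%:R) ^+ 2 :> R by rewrite expr_div_n.
  have := ler0n R (x %/ d); have : 0 <= x%:R / d%:R :> R by rewrite divr_ge0.
  rewrite -mulrA; move: (x%:R / d%:R : R) ((x %/ d)%:R : R) => u v u0 v0 uv.
  have [u1|u1] := lerP 1 u; nra.
rewrite [leLHS]big_mkcond [leRHS]big_mkcond /=.
rewrite big_nat_cond [leRHS]big_nat_cond; apply: ler_sum => d /andP[/andP[d1 dx] _].
case: ifP => // _; have d0 : 0 < d%:R :> R by rewrite ltr0n.
rewrite -exprVn -exprMn ler_pXn2r ?nnegrE ?divr_ge0 //.
by rewrite ler_pdivlMr // -natrM ler_nat leq_divM.
Unshelve. all: by end_near.
Qed.

End density.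
Section coprime_density.
Variable R : realType.

Lemma cvg_sum_seq (I : Type) (s : seq I) (P : pred I) (f : I -> nat -> R)
    (l : I -> R) : (forall i, P i -> f i x @[x --> \oo] --> l i) ->
  \sum_(i <- s | P i) f i x @[x --> \oo] --> \sum_(i <- s | P i) l i.
Proof. by apply: cvg_big; exact: add_continuous. Qed.

(** The two sides of [sum_class_totient] agree up to [o(x ^ 2)] when each
    [T q b y] is replaced with [c y ^ 2]; this is what determines [c]. *)
Lemma cvg_class_sum_error (q a : nat) (Z c : R) : (0 < q)%N ->
  coprime_inv_squares R q n @[n --> \oo] --> Z -> c * Z = (2 * q%:R)^-1 ->
  ((\sum_(1 <= k < x.+1 | k == a %[mod q]) k)%N%:R -
   c * \sum_(1 <= d < x.+1 | coprime d q) (x %/ d)%:R ^+ 2) / x%:R ^+ 2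
   @[x --> \oo] --> 0.
Proof.
move=> q0 cZ cE; rewrite -[X in _ --> X](subrr ((2 * q%:R)^-1)) -[in X in _ - X]cE.
under eq_fun do rewrite mulrBl -mulrA.
apply: cvgB; first exact: cvg_class_sum.
by apply: cvgMl_tmp; exact: cvg_floor_squares.
Qed.

(** The contraction is applied to the maximum [U x] of the errors
    [T q b x - c x ^ 2] over the classes [b] coprime to [q]: the recursion moves
    from the class of [b] to those of [b / d], so no single class satisfies a
    recursion of its own. *)
Lemma totient_class_sum_density (q a : nat) (Z : R) :
  (0 < q)%N -> coprime a q -> 0 < Z ->
  coprime_inv_squares R q n @[n --> \oo] --> Z ->
  (totient_class_sum q a x)%:R / x%:R ^+ 2 @[x --> \oo] --> (2 * q%:R * Z)^-1.
Proof.
move=> q0 aq Z0 cZ; set c := (2 * q%:R * Z)^-1.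
have cE : c * Z = (2 * q%:R)^-1.
  by rewrite /c; field; rewrite !gt_eqF ?ltr0n.
pose r b x : R := (totient_class_sum q b x)%:R - c * x%:R ^+ 2.
pose E b x : R := (\sum_(1 <= k < x.+1 | k == b %[mod q]) k)%N%:R -
   c * \sum_(1 <= d < x.+1 | coprime d q) (x %/ d)%:R ^+ 2.
pose U x : R := \big[Num.max/0]_(b < q | coprime b q) `|r b x|.
(* A sum bounds all the [`|E b x|] and, unlike a maximum, has an obvious limit. *)
pose eta x : R := \sum_(b < q) `|E b x|.
have rU b x : coprime b q -> `|r b x| <= U x.
  move=> bq; have -> : r b x = r (b %% q)%N x.
    by rewrite /r (@eq_totient_class_sum q b (b %% q)) // modn_mod.
  pose b' := Ordinal (ltn_pmod b q0); have b'q : coprime b' q by rewrite coprime_modl.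
  by rewrite -[(b %% q)%N]/(nat_of_ord b') (le_bigmax_cond _ _ b'q).
have U0 x : 0 <= U x by exact: bigmax_ge_id.
have rE b x : coprime b q ->
    \sum_(1 <= d < x.+1 | coprime d q) r (b * d ^ (totient q).-1)%N (x %/ d)%N = E b x.
  move=> bq; rewrite /E sum_class_totient // natr_sum big_distrr /= -sumrB.
  by apply: eq_bigr.
have rrec b x : coprime b q ->
    `|r b x| <= `|E b x| + \sum_(2 <= d < x.+1) U (x %/ d)%N.
  move=> bq; case: x => [|x].
    by rewrite /r /totient_class_sum !big_geq // expr0n mulr0 subrr normr0 addr0.
  have := rE b x.+1 bq; rewrite big_ltn_cond // coprime1n exp1n muln1 divn1 => <-.
  set s := \sum_(_ <= _ < _ | coprime _ _) _.
  apply: (@le_trans _ _ (`|r b x.+1 + s| + `|s|)).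
    by rewrite -{1}[r b x.+1](addrK s) ler_normB.
  rewrite lerD2l /s; apply: le_trans (ler_norm_sum _ _ _) _.
  rewrite big_mkcond; apply: ler_sum => d _; case: ifP => // dq.
  by apply: rU; rewrite coprimeMl bq coprimeXl.
have eta0 : eta x / x%:R ^+ 2 @[x --> \oo] --> 0.
  rewrite /eta; under eq_fun do rewrite big_distrl /=.
  have -> : nbhs (0 : R) = nbhs (\sum_(b < q) (0 : R)) by rewrite big1.
  apply: (@cvg_sum_seq _ _ _ _ (fun=> 0)) => b _.
  have /cvg_norm := cvg_class_sum_error b q0 cZ cE; rewrite normr0.
  apply: cvg_trans; apply: near_eq_cvg; apply: nearW => x.
  by rewrite normrM [X in _ * X]ger0_norm // invr_ge0 sqr_ge0.
have UB x : 0 <= U x <= (1 + `|c|) * x%:R ^+ 2.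
  rewrite U0 /=; apply: bigmax_le => [|b _].
    by rewrite mulr_ge0 ?sqr_ge0 ?addr_ge0.
  apply: le_trans (ler_normB _ _) _; rewrite normrM mulrDl mul1r.
  rewrite [X in _ * X]ger0_norm ?sqr_ge0 // lerD2r ger0_norm //.
  by rewrite -natrX ler_nat totient_class_sum_leq.
have Urec x : U x <= eta x + \sum_(2 <= d < x.+1) U (x %/ d)%N.
  apply: bigmax_le => [|b bq]; first by rewrite addr_ge0 ?sumr_ge0.
  apply: le_trans (rrec _ _ bq) _; rewrite lerD2r /eta (bigD1 b) //=.
  by rewrite lerDl sumr_ge0.
have Ulim := contraction_negligible UB Urec eta0.
have rlim : r a x / x%:R ^+ 2 @[x --> \oo] --> 0.
  have c0 : (fun _ : nat => 0 : R) @ \oo --> (0 : R) by exact: cvg_cst.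
  apply/norm_cvg0P.
  apply: squeeze_cvgr c0 Ulim; near=> x.
  rewrite normr_ge0 normrM [X in _ * X]ger0_norm ?invr_ge0 ?sqr_ge0 //=.
  by rewrite ler_wpM2r ?invr_ge0 ?sqr_ge0 // rU.
have clim : (fun _ : nat => c) @ \oo --> c by exact: cvg_cst.
have lim := cvgD rlim clim; rewrite add0r in lim.
apply: cvg_trans (lim _); apply: near_eq_cvg; near=> x.
have x0 : 0 < x%:R :> R by rewrite ltr0n; near: x; exact: nbhs_infty_gt.
by rewrite !fctE /r mulrBl mulfK ?subrK // expf_neq0 // gt_eqF.
Unshelve. all: by end_near.
Qed.

End coprime_density.

(** * The sum of the inverse squares of the odd numbers *)

Section basel.
Variable R : realType.
Implicit Types x : R.

Lemma sin_le_id x : 0 < x < pi / 2 -> sin x <= x.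
Proof.
case/andP=> x0 xp.
have sincont : {within `[0, x], continuous (@sin R)}.
  by apply: continuous_subspaceT => y; exact: continuous_sin.
have [c _] := MVT x0 (fun y _ => is_derive_sin y) sincont.
by rewrite sin0 !subr0 => ->; rewrite ger_pMl // cos_le1.
Qed.

Lemma id_le_tan x : 0 < x < pi / 2 -> x <= tan x.
Proof.
case/andP=> x0 xp.
have cos0 y : 0 <= y <= x -> 0 < cos y.
  move=> /andP[y0 yx]; apply: cos_gt0_pihalf; rewrite (le_lt_trans yx) // andbT.
  by apply: lt_le_trans y0; rewrite oppr_lt0 divr_gt0 // pi_gt0.
have tander y : y \in `]0, x[ -> is_derive y 1 tan (cos y ^- 2).
  rewrite in_itv /= => /andP[y0 yx]; apply: is_derive_tan.
  by rewrite gt_eqF // cos0 // !ltW.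
have tancont : {within `[0, x], continuous (@tan R)}.
  apply: continuous_in_subspaceT => y; rewrite inE /= in_itv /= => yx.
  by apply: continuous_tan; rewrite gt_eqF // cos0.
have [c] := MVT x0 tander tancont.
rewrite in_itv /= => /andP[c0 cx]; rewrite tan0 !subr0 => ->.
rewrite ler_pMl // invf_ge1 ?exprn_gt0 ?cos0 ?(ltW c0) ?(ltW cx) //.
Qed.

(** From [sin x <= x <= tan x], as [1 / tan x ^ 2 = 1 / sin x ^ 2 - 1]. *)
Lemma inv_sqr_bounds x : 0 < x < pi / 2 ->
  sin x ^- 2 - 1 <= x ^- 2 <= sin x ^- 2.
Proof.
move=> xp; have s0 := sin_gt0_pihalf xp.
have c0 : 0 < cos x.
  apply: cos_gt0_pihalf; case/andP: xp => x0 ->; rewrite andbT.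
  by apply: lt_trans x0; rewrite oppr_lt0 divr_gt0 // pi_gt0.
have x0 : 0 < x by case/andP: xp.
apply/andP; split; last first.
  rewrite lef_pV2 ?posrE ?exprn_gt0 //.
  by rewrite ler_pXn2r ?nnegrE ?(ltW s0) ?(ltW x0) // sin_le_id.
have -> : sin x ^- 2 - 1 = tan x ^- 2.
  rewrite /tan expr_div_n invf_div cos2sin2 mulrBl mul1r divff //.
  by rewrite sqrf_eq0 gt_eqF.
have t0 : 0 < tan x by rewrite divr_gt0.
rewrite lef_pV2 ?posrE ?exprn_gt0 //.
by rewrite ler_pXn2r ?nnegrE ?(ltW t0) ?(ltW x0) // id_le_tan.
Qed.

Lemma inv_sqr_sin_double x : sin x != 0 -> cos x != 0 ->
  sin x ^- 2 + cos x ^- 2 = 4 * sin (x *+ 2) ^- 2.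
Proof.
move=> s0 c0; rewrite sin_mulr2n -mulr_natr.
have := cos2Dsin2 x; move: (sin x) (cos x) s0 c0 => s c s0 c0 sc.
transitivity ((c ^+ 2 + s ^+ 2) / (s ^+ 2 * c ^+ 2)); first by field; rewrite ?s0 ?c0.
by rewrite sc; field; rewrite ?s0 ?c0.
Qed.

(** The [2 ^ n] odd multiples of [pi / 2 ^ (n + 2)] in the interval from [0] to
    [pi / 2]. *)
Let theta (n k : nat) : R := k.*2.+1%:R * pi / 2 ^+ n.+2.

Lemma theta_bounds n k : (k < 2 ^ n)%N -> 0 < theta n k < pi / 2.
Proof.
move=> kn; rewrite /theta; apply/andP; split.
  exact: divr_gt0 (mulr_gt0 (ltr0Sn _ _) (pi_gt0 R)) (exprn_gt0 _ (ltr0Sn _ 1)).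
rewrite ltr_pdivrMr ?exprn_gt0 // exprS mulrA divfK // mulrC ltr_pM2l ?pi_gt0 //.
by rewrite -natrX ltr_nat expnS mul2n -doubleS leq_double.
Qed.

(** The points [theta n.+1 k] and [pi / 2 - theta n.+1 k] of level [n + 1] both
    come from [theta n k = 2 * theta n.+1 k], so the duplication formula
    multiplies the sum by [4] at each level. *)
Lemma sum_inv_sqr_sin n : \sum_(0 <= k < 2 ^ n) sin (theta n k) ^- 2 = 2 * 4 ^+ n :> R.
Proof.
elim: n => [|n IH].
  rewrite big_nat1 /theta expr0 mulr1.
  have -> : 1%:R * pi / 2 ^+ 2 = pi / 4 :> R by field.
  have p4 : 0 < (pi / 4 : R) < pi / 2.
    by have p0 := pi_gt0 R; apply/andP; split; lra.
  have s0 := sin_gt0_pihalf p4.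
  have cs : cos (pi / 4) = sin (pi / 4) :> R.
    by rewrite -cosBpihalf -cosN; congr cos; field.
  have := @inv_sqr_sin_double (pi / 4); rewrite cs => /(_ _ _)/wrap[||];
    try by rewrite gt_eqF.
  have -> : (pi / 4) *+ 2 = pi / 2 :> R by rewrite -mulr_natr; field.
  by rewrite sin_pihalf expr1n invr1; lra.
have double k : theta n k = theta n.+1 k *+ 2.
  by rewrite /theta -mulr_natr [in RHS]exprS; field; rewrite expf_neq0.
have reflect k : (k < 2 ^ n)%N ->
    theta n.+1 (2 ^ n - k.+1 + 2 ^ n) = pi / 2 - theta n.+1 k.
  move=> kn; rewrite /theta.
  have -> : (2 ^ n - k.+1 + 2 ^ n).*2.+1%:R = 2 ^+ n.+2 - k.*2.+1%:R :> R.
    rewrite -natrX -natrB; last by rewrite !expnS; lia.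
    by congr (_%:R); rewrite !expnS; lia.
  by rewrite [2 ^+ n.+3]exprS; field; rewrite expf_neq0.
(* The upper half of the indices, read backwards, is the reflection of the lower
   half. *)
rewrite (@big_cat_nat _ _ _ (2 ^ n)) //=; last by rewrite leq_exp2l.
rewrite -{2}[(2 ^ n)%N]add0n big_addn expnS mul2n -addnn addnK.
rewrite [X in _ + X]big_nat_rev /=.
rewrite -big_split /= exprS mulrCA -IH big_distrr /= big_nat_cond [RHS]big_nat_cond.
apply: eq_bigr => k /andP[/andP[_ kn] _].
rewrite add0n reflect // -opprB sinN sinBpihalf opprK double.
have kn1 : (k < 2 ^ n.+1)%N by rewrite (leq_trans kn) // leq_exp2l.
have /andP[t0 tp] := theta_bounds kn1.
rewrite inv_sqr_sin_double // gt_eqF //; first by rewrite sin_gt0_pihalf // t0.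
apply: cos_gt0_pihalf; rewrite tp andbT.
by apply: lt_trans t0; rewrite oppr_lt0 divr_gt0 // pi_gt0.
Qed.

(** Summing [1 / sin t ^ 2 - 1 <= 1 / t ^ 2 <= 1 / sin t ^ 2] over the points
    [theta n k]. *)
Lemma sum_odd_inv_squares_bounds n :
  pi ^+ 2 / 16 * (2 - 2 ^- n) <=
  \sum_(0 <= k < 2 ^ n) (k.*2.+1%:R : R) ^- 2 <= pi ^+ 2 / 8.
Proof.
have four : 4 ^+ n = 2 ^+ n ^+ 2 :> R.
  by rewrite -exprM mulnC exprM; congr (_ ^+ _); ring.
have -> : \sum_(0 <= k < 2 ^ n) (k.*2.+1%:R : R) ^- 2 =
    (pi ^+ 2 / 16) * (4 ^- n * \sum_(0 <= k < 2 ^ n) theta n k ^- 2) :> R.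
  rewrite !big_distrr /=; apply: eq_bigr => k _; rewrite /theta four.
  have := pnatr_eq0 R k.*2.+1; move: (k.*2.+1%:R : R) => y /= /negbT y0.
  have : pi != 0 :> R by rewrite gt_eqF ?pi_gt0.
  move: (pi : R) => x x0; rewrite !exprS; field.
  by rewrite y0 x0 expf_neq0.
have pi0 : 0 <= pi ^+ 2 / 16 :> R by rewrite divr_ge0 ?sqr_ge0.
have -> : pi ^+ 2 / 8 = pi ^+ 2 / 16 * 2 :> R by field.
have four0 : (0 : R) < 4 ^+ n by rewrite exprn_gt0.
apply/andP; split; apply: ler_wpM2l => //.
  rewrite -(ler_pM2l four0) mulVKf ?gt_eqF //.
  have -> : 4 ^+ n * (2 - 2 ^- n) = 2 * 4 ^+ n - 2 ^+ n :> R.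
    by rewrite four; field; rewrite expf_neq0.
  have -> : 2 ^+ n = \sum_(0 <= k < 2 ^ n) 1 :> R.
    by rewrite sumr_const_nat subn0 -natrX.
  rewrite -sum_inv_sqr_sin -sumrB big_nat_cond [leRHS]big_nat_cond.
  apply: ler_sum => k /andP[/andP[_ kn] _].
  by have /andP[] := inv_sqr_bounds (theta_bounds kn).
rewrite -(ler_pM2l four0) mulVKf ?gt_eqF // mulrC -sum_inv_sqr_sin.
rewrite big_nat_cond [leRHS]big_nat_cond; apply: ler_sum => k /andP[/andP[_ kn] _].
by have /andP[] := inv_sqr_bounds (theta_bounds kn).
Qed.

End basel.

(** * Euler factors *)

Section euler_factors.
Variable R : realType.
Local Notation S := (coprime_inv_squares R).

Lemma cvg_divn (r : nat) : (0 < r)%N -> (fun n => n %/ r)%N @ \oo --> \oo.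
Proof.
move=> r0; apply/cvgnyPge => m; near=> n; rewrite leq_divRL //.
by near: n; exact: nbhs_infty_ge.
Unshelve. all: by end_near.
Qed.

Lemma coprime_inv_squares_homo (q : nat) :
  {homo S q : m n / (m <= n)%N >-> m <= n}.
Proof.
move=> m n mn; rewrite /coprime_inv_squares.
rewrite [leRHS](@big_cat_nat _ _ _ m.+1) //= lerDl.
by apply: sumr_ge0 => d _; rewrite invr_ge0 sqr_ge0.
Qed.

(** The [d] coprime to [q] but not to [r * q] are the [r * e] with [e] coprime to
    [q]. *)
Lemma coprime_inv_squares_prime (q r n : nat) : prime r -> coprime r q ->
  S (r * q) n = S q n - r%:R ^- 2 * S q (n %/ r)%N.
Proof.
move=> pr rq; have r0 := prime_gt0 pr.
rewrite /coprime_inv_squares [X in _ = X - _](bigID (fun d => r %| d)%N) /=.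
have -> : \sum_(1 <= d < n.+1 | coprime d q && (r %| d)%N) d%:R ^- 2 =
    r%:R ^- 2 * \sum_(1 <= e < (n %/ r).+1 | coprime e q) (e%:R : R) ^- 2 :> R.
  under eq_bigl do rewrite andbC.
  rewrite big_mkcondr sum_multiples // [in RHS]big_mkcond big_distrr /=.
  apply: eq_bigr => e _; rewrite coprimeMl rq /=.
  by case: ifP => _; rewrite ?mulr0 // natrM exprMn invfM.
rewrite addrAC subrr add0r; apply: eq_bigl => d.
by rewrite coprimeMr [coprime d r]coprime_sym prime_coprime // andbC.
Qed.

Lemma cvg_coprime_inv_squares_prime (q r : nat) (Z : R) :
  prime r -> coprime r q -> S q n @[n --> \oo] --> Z ->
  S (r * q) n @[n --> \oo] --> (1 - r%:R ^- 2) * Z.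
Proof.
move=> pr rq cZ; under eq_fun do rewrite coprime_inv_squares_prime //.
rewrite mulrBl mul1r; apply: cvgB => //; apply: cvgMl_tmp.
exact: cvg_comp (cvg_divn (prime_gt0 pr)) cZ.
Qed.

(** The bounds of [sum_odd_inv_squares_bounds] concern the partial sums of index
    [2 ^ (n + 1)] only; monotonicity extends the limit to the whole sequence. *)
Lemma cvg_odd_inv_squares : S 2 n @[n --> \oo] --> (pi ^+ 2 / 8 : R).
Proof.
have SE m : S 2 (2 * m) = \sum_(0 <= k < m) k.*2.+1%:R ^- 2.
  rewrite /coprime_inv_squares.
  transitivity (\sum_(1 <= d < (2 * m).+1 | d == 1 %[mod 2]) (d%:R : R) ^- 2).
    by apply: eq_bigl => d; rewrite coprimen2 modn2 eqb1.
  rewrite (@sum_class_blocks R) //; apply: eq_bigr => k _.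
  by rewrite addn1 mul2n.
have pow : (fun n => 2 * 2 ^ n)%N @ \oo --> \oo.
  apply/cvgnyPge => m; near=> n.
  rewrite (@leq_trans n) //; first by near: n; exact: nbhs_infty_ge.
  by rewrite -expnS ltnW // (leq_trans (ltnSn n)) // ltnW // ltn_expl.
have sub : S 2 (2 * 2 ^ n)%N @[n --> \oo] --> (pi ^+ 2 / 8 : R).
  have lo : pi ^+ 2 / 16 * (2 - 2 ^- n) @[n --> \oo] --> (pi ^+ 2 / 8 : R).
    have -> : nbhs (pi ^+ 2 / 8 : R) = nbhs (pi ^+ 2 / 16 * (2 - 0) : R).
      by congr nbhs; field.
    apply: cvgMl_tmp; apply: cvgB; first exact: cvg_cst.
    under eq_fun do rewrite -exprVn.
    by apply: cvg_expr; rewrite ger0_norm ?invr_ge0 // invf_lt1 // ltr1n.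
  have hi : (fun _ : nat => pi ^+ 2 / 8) @ \oo --> (pi ^+ 2 / 8 : R) by exact: cvg_cst.
  apply: squeeze_cvgr lo hi; apply: nearW => n; rewrite SE.
  exact: sum_odd_inv_squares_bounds.
have bnd : has_ubound (range (S 2)).
  exists (pi ^+ 2 / 8) => _ [n _ <-].
  apply: (@le_trans _ _ (S 2 (2 * 2 ^ n)%N)).
    apply: coprime_inv_squares_homo.
    by rewrite -expnS ltnW // (leq_trans (ltnSn n)) // ltnW // ltn_expl.
  by rewrite SE; have /andP[] := sum_odd_inv_squares_bounds R n.
have lim := nondecreasing_cvgn (@coprime_inv_squares_homo 2) bnd.
have lim2 : S 2 (2 * 2 ^ n)%N @[n --> \oo] --> sup (range (S 2)).
  exact: cvg_comp pow lim.
by rewrite -(cvg_unique _ lim2 sub).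
Unshelve. all: by end_near.
Qed.

(** Once the series is known to converge, the Euler factor [3 / 4] at [2] gives its
    sum from that of the odd terms. *)
Lemma cvg_inv_squares : S 1 n @[n --> \oo] --> (pi ^+ 2 / 6 : R).
Proof.
have bnd : has_ubound (range (S 1)).
  exists (1 + 3 / 4) => _ [[|n] _ <-]; rewrite /coprime_inv_squares.
    by rewrite big_geq // addr_ge0 // divr_ge0.
  rewrite big_ltn_cond //= expr1n invr1 lerD2l.
  apply: le_trans (sum_inv_sqr_ge2 R n.+1).
  by under eq_bigl do rewrite coprimen1.
have lim := nondecreasing_cvgn (@coprime_inv_squares_homo 1) bnd.
have lim2 := cvg_coprime_inv_squares_prime (isT : prime 2) (coprimen1 2) lim.
have E : (1 - 2%:R ^- 2) * sup (range (S 1)) = pi ^+ 2 / 8.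
  by rewrite -(cvg_unique _ lim2 cvg_odd_inv_squares).
suff -> : pi ^+ 2 / 6 = sup (range (S 1)) by [].
move: E; set s := sup _.
have -> : 1 - 2%:R ^- 2 = 3 / 4 :> R by field.
move: (pi ^+ 2) => P; lra.
Qed.

End euler_factors.

(** * Classes modulo twice an odd prime *)

Section residue_classes.
Variable R : realType.

Definition has_density (q a : nat) (c : R) : Prop :=
  (totient_class_sum q a x)%:R / x%:R ^+ 2 @[x --> \oo] --> c.

Let pi0 : (pi : R) != 0. Proof. by rewrite gt_eqF ?pi_gt0. Qed.

Lemma density_all : has_density 1 0 (3 / pi ^+ 2).
Proof.
have Z0 : 0 < pi ^+ 2 / 6 :> R by rewrite divr_gt0 ?exprn_gt0 ?pi_gt0.
have := totient_class_sum_density (isT : 0 < 1)%N (isT : coprime 0 1) Z0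
  (@cvg_inv_squares R).
rewrite /has_density; have -> // : (2 * 1%:R * (pi ^+ 2 / 6))^-1 = 3 / pi ^+ 2 :> R.
by have := pi0; move: (pi : R) => x x0; field.
Qed.

Lemma density_odd : has_density 2 1 (2 / pi ^+ 2).
Proof.
have Z0 : 0 < pi ^+ 2 / 8 :> R by rewrite divr_gt0 ?exprn_gt0 ?pi_gt0.
have := totient_class_sum_density (isT : 0 < 2)%N (isT : coprime 1 2) Z0
  (@cvg_odd_inv_squares R).
rewrite /has_density; have -> // : (2 * 2%:R * (pi ^+ 2 / 8))^-1 = 2 / pi ^+ 2 :> R.
by have := pi0; move: (pi : R) => x x0; field.
Qed.

(** For [q] odd and [a] even, the class of [a] modulo [q] splits by parity into two
    classes modulo [2 * q]: the even one is that of [a], the odd one is that of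
    [chinese q 2 a 1]. *)
Lemma density_even_class (q a : nat) (s t : R) : odd q -> ~~ odd a ->
  has_density q a s -> has_density (2 * q) (chinese q 2 a 1) t ->
  has_density (2 * q) a (s - t).
Proof.
move=> qo ae qs qt; have q2 : coprime q 2 by rewrite coprimen2.
rewrite /has_density.
under eq_fun => x.
  have -> : (totient_class_sum (2 * q) a x)%:R =
      (totient_class_sum q a x)%:R -
      (totient_class_sum (2 * q) (chinese q 2 a 1) x)%:R :> R.
    rewrite (@totient_class_sum_split q 2) // !big_ord_recl big_ord0 addn0 natrD mulnC.
    rewrite addrK; congr (_%:R); apply: eq_totient_class_sum; apply/eqP.
    rewrite chinese_remainder // chinese_modl // chinese_modr // eqxx modn2.
    by rewrite (negbTE ae).
  rewrite mulrBl; over.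
exact: cvgB.
Qed.

(** The integers congruent to [e] modulo [2] fall into [p] classes modulo [2 * p].
    All but the one made of multiples of [p] are prime to [p], and these have a
    common density [c]. *)
Lemma density_class_multiple (p e a : nat) (t c : R) : prime p -> odd p ->
  has_density 2 e t ->
  (forall b, coprime b p -> b = e %[mod 2] -> has_density (2 * p) b c) ->
  a = e %[mod 2] -> (p %| a)%N -> has_density (2 * p) a (t - (p%:R - 1) * c).
Proof.
move=> pp po et bc ae pa; have p2 : coprime 2 p by rewrite coprime2n.
have p0 := prime_gt0 pp; pose o := Ordinal p0.
rewrite /has_density.
under eq_fun => x.
  have -> : (totient_class_sum (2 * p) a x)%:R =
      (totient_class_sum 2 e x)%:R -
      \sum_(b < p | b != o) (totient_class_sum (2 * p) (chinese 2 p e b) x)%:R :> R.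
    rewrite (@totient_class_sum_split 2 p) // (bigD1 o) //= natrD natr_sum.
    rewrite addrK; congr (_%:R); apply: eq_totient_class_sum; apply/eqP.
    by rewrite chinese_remainder // chinese_modl // chinese_modr // ae eqxx mod0n.
  rewrite mulrBl big_distrl /=; over.
apply: cvgB => //.
have -> : (p%:R - 1) * c = \sum_(b < p | b != o) c.
  rewrite sumr_const -[RHS]mulr_natl (_ : (p%:R - 1) = p.-1%:R); last first.
    by rewrite -subn1 natrB.
  by congr (_%:R * _); have := cardC1 o; rewrite card_ord => <-; apply: eq_card.
apply: cvg_sum_seq => b bo; apply: bc; last by rewrite chinese_modl.
rewrite coprime_sym prime_coprime // /dvdn chinese_modr //.
by rewrite modn_small.
Qed.

Variable p : nat.
Hypotheses (p_prime : prime p) (p_odd : odd p).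

Let P2 : 2 <= p%:R :> R. Proof. by rewrite ler_nat prime_gt1. Qed.
Let Psq : 0 < p%:R ^+ 2 - 1 :> R.
Proof. by rewrite subr_gt0 exprn_egt1 // ltr1n prime_gt1. Qed.

Lemma euler_factor_gt0 : 0 < 1 - p%:R ^- 2 :> R.
Proof.
rewrite subr_gt0 invf_lt1 ?exprn_gt0 ?ltr0n ?prime_gt0 //.
by rewrite exprn_egt1 // ltr1n prime_gt1.
Qed.

Lemma density_coprime_p (a : nat) : coprime a p ->
  has_density p a (3 * p%:R / ((p%:R ^+ 2 - 1) * pi ^+ 2)).
Proof.
move=> ap.
have := cvg_coprime_inv_squares_prime p_prime (coprimen1 p) (@cvg_inv_squares R).
rewrite muln1 => /(totient_class_sum_density (prime_gt0 p_prime) ap).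
rewrite /has_density; have -> : (2 * p%:R * ((1 - p%:R ^- 2) * (pi ^+ 2 / 6)))^-1 =
  3 * p%:R / ((p%:R ^+ 2 - 1) * pi ^+ 2) :> R.
  have := Psq; have := P2; have := pi0.
  move: (p%:R : R) (pi : R) => P x x0 P2' Psq'; field.
  by rewrite x0 !gt_eqF // (lt_le_trans _ P2').
by apply; rewrite mulr_gt0 ?euler_factor_gt0 ?divr_gt0 ?exprn_gt0 ?pi_gt0.
Qed.

Lemma density_coprime_2p (a : nat) : odd a -> coprime a p ->
  has_density (2 * p) a (2 * p%:R / ((p%:R ^+ 2 - 1) * pi ^+ 2)).
Proof.
move=> ao ap; have a2p : coprime a (2 * p) by rewrite coprimeMr coprimen2 ao.
have q0 : (0 < 2 * p)%N by rewrite muln_gt0 (prime_gt0 p_prime).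
have p2 : coprime p 2 by rewrite coprimen2.
have := cvg_coprime_inv_squares_prime p_prime p2 (@cvg_odd_inv_squares R).
rewrite mulnC => /(totient_class_sum_density q0 a2p).
rewrite natrM /has_density.
have -> : (2 * (2 * p%:R) * ((1 - p%:R ^- 2) * (pi ^+ 2 / 8)))^-1 =
  2 * p%:R / ((p%:R ^+ 2 - 1) * pi ^+ 2) :> R.
  have := Psq; have := P2; have := pi0.
  move: (p%:R : R) (pi : R) => P x x0 P2' Psq'; field.
  by rewrite x0 !gt_eqF // (lt_le_trans _ P2').
by apply; rewrite mulr_gt0 ?euler_factor_gt0 ?divr_gt0 ?exprn_gt0 ?pi_gt0.
Qed.

Lemma density_even_coprime_p (a : nat) : ~~ odd a -> coprime a p ->
  has_density (2 * p) a (p%:R / ((p%:R ^+ 2 - 1) * pi ^+ 2)).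
Proof.
move=> ae ap; have p2 : coprime p 2 by rewrite coprimen2.
have bp : coprime (chinese p 2 a 1) p.
  by rewrite -coprime_modl chinese_modl // coprime_modl.
have bo : odd (chinese p 2 a 1).
  by have := chinese_modr p2 a 1; rewrite modn2; case: odd.
have := density_even_class p_odd ae (density_coprime_p ap) (density_coprime_2p bo bp).
by rewrite -mulrBl -mulrBl (_ : 3 - 2 = 1) ?mul1r //; ring.
Qed.

Lemma density_p : has_density (2 * p) p (2 / ((p%:R + 1) * pi ^+ 2)).
Proof.
have dens b : coprime b p -> b = 1 %[mod 2] ->
    has_density (2 * p) b (2 * p%:R / ((p%:R ^+ 2 - 1) * pi ^+ 2)).
  by move=> bp; rewrite modn2 => bo; apply: density_coprime_2p bp; case: odd bo.
have p1 : p = 1 %[mod 2] by rewrite modn2 p_odd.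
have -> : 2 / ((p%:R + 1) * pi ^+ 2) =
    2 / pi ^+ 2 - (p%:R - 1) * (2 * p%:R / ((p%:R ^+ 2 - 1) * pi ^+ 2)) :> R.
  have := Psq; have := P2; have := pi0.
  move: (p%:R : R) (pi : R) => P x x0 P2' Psq'; field.
  by rewrite x0 !gt_eqF //; lra.
exact: density_class_multiple p_prime p_odd density_odd dens p1 (dvdnn p).
Qed.

Lemma density_0 : has_density (2 * p) 0 (1 / ((p%:R + 1) * pi ^+ 2)).
Proof.
have dens b : coprime b p -> b = 0 %[mod 2] ->
    has_density (2 * p) b (p%:R / ((p%:R ^+ 2 - 1) * pi ^+ 2)).
  by move=> bp; rewrite modn2 => bo; apply: density_even_coprime_p bp; case: odd bo.
have even : has_density 2 0 (3 / pi ^+ 2 - 2 / pi ^+ 2).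
  apply: (@density_even_class 1 0) => //; first exact: density_all.
  exact: density_odd.
have -> : 1 / ((p%:R + 1) * pi ^+ 2) = 3 / pi ^+ 2 - 2 / pi ^+ 2 -
    (p%:R - 1) * (p%:R / ((p%:R ^+ 2 - 1) * pi ^+ 2)) :> R.
  have := Psq; have := P2; have := pi0.
  move: (p%:R : R) (pi : R) => P x x0 P2' Psq'; field.
  by rewrite x0 !gt_eqF //; lra.
exact: density_class_multiple p_prime p_odd even dens erefl (dvdn0 p).
Qed.

(** The limit along all [x] is specialized to [x = 2pn], where the blocks of length
    [2p] are complete. *)
Lemma totient_AP_sum_cvg (j : nat) (c : R) : (j < 2 * p)%N ->
  has_density (2 * p) (2 * p - j) c ->
  (totient_AP_sum p j n)%:R / (2 * p * n)%:R ^+ 2 @[n --> \oo] --> c.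
Proof.
move=> jp dens; have p0 := prime_gt0 p_prime.
have TE n : totient_AP_sum p j n = totient_class_sum (2 * p) (2 * p - j) (2 * p * n).
  rewrite /totient_class_sum (@sum_class_blocks nat) ?subn_gt0 ?jp ?leq_subr //.
  rewrite /totient_AP_sum big_add1 /=; apply: eq_bigr => m _; congr totient.
  by rewrite mulnS addnC addnBA // ltnW.
have lim : (fun n => 2 * p * n)%N @ \oo --> \oo.
  apply/cvgnyPge => m; near=> n; rewrite (@leq_trans n) ?leq_pmull ?muln_gt0 //.
  by near: n; exact: nbhs_infty_ge.
under eq_fun do rewrite TE.
exact: cvg_comp lim dens.
Unshelve. all: by end_near.
Qed.

End residue_classes.

Lemma odd_double_sub (m j : nat) : (j <= 2 * m)%N -> odd (2 * m - j) = odd j.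
Proof. by move=> jm; rewrite oddB // oddM. Qed.

Theorem theorem3 (R : realType) (p : nat) (p_prime : prime p) (p_odd : odd p) :
  (* (a) *)
  ((forall j : nat, ~~ odd j -> (2 <= j <= 2 * p - 2)%N ->
      (totient_AP_sum p j n)%:R / ((2 * p * n)%:R ^+ 2) @[n --> \oo]
        --> (p%:R / ((p%:R ^+ 2 - 1) * pi ^+ 2) : R)) /\
   ((totient_AP_sum p 0 n)%:R / ((2 * p * n)%:R ^+ 2) @[n --> \oo]
        --> (1 / ((p%:R + 1) * pi ^+ 2) : R))) /\
  (* (b) *)
  ((forall j : nat, odd j -> (1 <= j <= 2 * p - 1)%N -> j != p ->
      (totient_AP_sum p j n)%:R / ((2 * p * n)%:R ^+ 2) @[n --> \oo]
        --> (2 * p%:R / ((p%:R ^+ 2 - 1) * pi ^+ 2) : R)) /\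
   ((totient_AP_sum p p n)%:R / ((2 * p * n)%:R ^+ 2) @[n --> \oo]
        --> (2 / ((p%:R + 1) * pi ^+ 2) : R))).
Proof.
have p0 := prime_gt0 p_prime; have p2 : (0 < 2 * p)%N by rewrite muln_gt0.
have odd_sub j : (j < 2 * p)%N -> odd (2 * p - j) = odd j.
  by move/ltnW; exact: odd_double_sub.
have coprime_sub j : (0 < j < 2 * p)%N -> j != p -> coprime (2 * p - j) p.
  move=> /andP[j0 jp] jnp; rewrite coprime_sym prime_coprime //.
  rewrite dvdn_subr ?dvdn_mull ?(ltnW jp) //.
  apply/negP => /dvdnP[k jk]; move: j0 jp jnp.
  by rewrite jk ltn_pmul2r // muln_gt0; case: k {jk} => [|[|k]] //; rewrite mul1n eqxx.
have lt_sub k : (0 < k)%N -> (2 * p - k < 2 * p)%N by rewrite ltn_subrL p2 andbT.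
split; split.
- move=> j je /andP[j2 /leq_ltn_trans/(_ (lt_sub 2 isT))jp].
  apply: totient_AP_sum_cvg => //.
  apply: density_even_coprime_p => //; first by rewrite odd_sub.
  apply: coprime_sub; first by rewrite (leq_trans _ j2).
  by apply: contraNneq je => ->.
- apply: totient_AP_sum_cvg => //; rewrite subn0 /has_density.
  under eq_fun do rewrite (@eq_totient_class_sum _ _ 0) ?modnn ?mod0n //.
  exact: density_0.
- move=> j jo /andP[j1 /leq_ltn_trans/(_ (lt_sub 1 isT))jp] jnp.
  apply: totient_AP_sum_cvg => //.
  apply: density_coprime_2p => //; first by rewrite odd_sub.
  by apply: coprime_sub => //; rewrite j1.
- apply: totient_AP_sum_cvg => //; first by rewrite ltn_Pmull.
  have -> : (2 * p - p = p)%N by rewrite mul2n -addnn addnK.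
  exact: density_p.
Qed.
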